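(* Assume that the weakness sequences $\tau=\{t_k\}_{k=1}^\infty$ are monotone, $t_1\ge t_2\ge\dots$. Then the following condition on the weakness sequences $\tau$ $$\sum_{k=1}^\infty\frac{t_k}{k}=\infty$$ is the necessary and sufficient condition for the $A_1(\mathcal{D})$-convergence of the Weak Greedy Algorithm WGA($\tau$) for all dictionaries $\mathcal{D}$.
   Context: $H$ is a real Hilbert space with inner product $\langle\cdot,\cdot\rangle$ and norm $\|x\|=\langle x,x\rangle^{1/2}$. A dictionary is a set $\mathcal{D}\subset H$ such that $\|g\|=1$ for every $g\in\mathcal{D}$ and the closure of the linear span of $\mathcal{D}$ is $H$. $A_1(\mathcal{D})$ is the closure in $H$ of the convex hull of $\{\pm g: g\in\mathcal{D}\}$. A weakness sequence is a sequence $\tau=\{t_k\}_{k=1}^\infty$ of numbers $t_k\in[0,1]$. Weak Greedy Algorithm WGA($\mathcal{D},\tau$) (also written WGA($\tau$)): given $f\in H$, put $f_0=f$. For each $m\ge1$, inductively: (i) $\varphi_m\in\mathcal{D}$ is any element satisfying $|\langle f_{m-1},\varphi_m\rangle|\ge t_m\sup_{g\in\mathcal{D}}|\langle f_{m-1},g\rangle|$ (if $t_m=1$ it is assumed that such a maximizer exists); (ii) $f_m=f_{m-1}-\langle f_{m-1},\varphi_m\rangle\varphi_m$. A realization is any outcome of admissible choices of the $\varphi_m$. The algorithm $A_1(\mathcal{D})$-converges if, for the given dictionary $\mathcal{D}$ and each $f\in A_1(\mathcal{D})$, every realization of the algorithm satisfies $\lim_{m\to\infty}\|f_m\|=0$.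 *)

(* Defs.v *)
From HB Require Import structures.
From mathcomp Require Import all_boot all_order all_algebra.
From mathcomp Require Import all_classical all_reals all_analysis.

Set Implicit Arguments.
Unset Strict Implicit.
Unset Printing Implicit Defensive.

Import Order.TTheory GRing.Theory Num.Theory.
Import numFieldNormedType.Exports.

Local Open Scope classical_set_scope.
Local Open Scope ring_scope.

Section WeakGreedy.
Variables (R : realType) (H : completeNormedModType R).

(* With [hilbert_norm ip], the complete normed space [H] is a real Hilbert
   space whose inner product is [ip]. *)
Definition hilbert_norm (ip : {dot H for idfun}) : Prop :=
  forall x : H, `|x| = Num.sqrt (ip x x).

Definition linear_span (D : set H) : set H :=
  [set x | exists (n : nat) (c : 'I_n -> R) (g : 'I_n -> H),
     (forall i, D (g i)) /\ x = \sum_(i < n) c i *: g i].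

Definition convex_hull (A : set H) : set H :=
  smallest (@convex_set R H) A.

Definition dictionary (D : set H) : Prop :=
  (forall g, D g -> `|g| = 1) /\ closure (linear_span D) = setT.

Definition A1 (D : set H) : set H :=
  closure (convex_hull (D `|` [set - g | g in D])).

(* The residual f_m obtained from f_0 = f by the choices phi_1, ..., phi_m;
   the value [phi 0] is never used. *)
Fixpoint residual (ip : {dot H for idfun}) (f : H) (phi : nat -> H) (m : nat)
    : H :=
  if m is m'.+1 then
    let r := residual ip f phi m' in r - ip r (phi m) *: phi m
  else f.

(* When t_m = 1, or when D is empty, there may be no admissible choice of
   phi_m; the process then has no (infinite) realization.  The supremum is
   finite because |<x, g>| <= |x| for g in D. *)
Definition wga_realization (ip : {dot H for idfun}) (D : set H) (t : nat -> R)
    (f : H) (phi : nat -> H) : Prop :=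
  forall m, (0 < m)%N ->
    D (phi m) /\
    t m * sup [set `|ip (residual ip f phi m.-1) g| | g in D]
      <= `|ip (residual ip f phi m.-1) (phi m)|.

Definition A1_converges (ip : {dot H for idfun}) (D : set H) (t : nat -> R)
    : Prop :=
  forall f phi, A1 D f -> wga_realization ip D t f phi ->
    `|residual ip f phi m| @[m --> \oo] --> (0 : R).

End WeakGreedy.

(* Sequences t_1, t_2, ... are functions on nat whose value at 0 is ignored. *)
Definition weakness_sequence (R : realType) (t : nat -> R) : Prop :=
  forall k, (0 < k)%N -> 0 <= t k <= 1.

(* Main.v *)
(* Sufficiency. Let a_k = |<f_{k-1}, phi_k>| and suppose |f_m|^2 >= e > 0 for all m. Expanding
   one factor of <f_m, f_m> along f_m = f - sum_{k <= m} +-a_k phi_k and using f in A_1(D),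
   |f_m|^2 <= sup_g |<f_m, g>| (1 + a_1 + ... + a_m), hence
   e t_{m+1} <= a_{m+1} (1 + a_1 + ... + a_m). Divided by m + 1, the right-hand side is summable
   by Hardy's inequality, as sum a_k^2 <= |f|^2; so sum t_k / k < oo.

   Necessity. In l^2 with basis (e_i), a multiple of e_j is turned into equal multiples of
   e_{2j+1} and e_{2j+2} by n successive projections on lines of the plane spanned by e_j and
   e_{2j+1} + e_{2j+2}. Each of them has a coefficient of order 1/n relative to the current
   coordinate, so it is admissible as soon as t <= 1/(4n), while the whole splitting loses only
   a fraction O(1/n) of the squared norm. Splitting the nodes of the binary tree in
   breadth-first order, with n_s of order 1/t_{2^s} at level s (step numbers there are at least
   2^s), the total relative loss is O(sum_s t_{2^s}) over the levels that are split, and this is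
   small by Cauchy condensation if the first levels are skipped. *)
From HB Require Import structures.
Require Import Defs.
From mathcomp Require Import all_boot all_order all_algebra.
From mathcomp Require Import all_classical all_reals all_analysis.
From mathcomp Require Import ring lra zify.
Import Order.TTheory GRing.Theory Num.Theory.
Import numFieldNormedType.Exports.
Local Open Scope classical_set_scope.
Local Open Scope ring_scope.

(** * Real inner products *)

Section dot_theory.
Context {R : rcfType} {U : lmodType R} (ip : {dot U for idfun}).
Implicit Types u v : U.

Lemma ipC u v : ip u v = ip v u.
Proof. by rewrite hermC expr0 mul1r. Qed.

Lemma ipDl u v w : ip (u + v) w = ip u w + ip v w.
Proof. exact: linearDl. Qed.

Lemma ipBl u v w : ip (u - v) w = ip u w - ip v w.
Proof. exact: linearBl. Qed.

Lemma ipBr u v w : ip w (u - v) = ip w u - ip w v.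
Proof. exact: linearBr. Qed.

Lemma ipDr u v w : ip w (u + v) = ip w u + ip w v.
Proof. exact: linearDr. Qed.

Lemma ipNr u v : ip u (- v) = - ip u v.
Proof. exact: linearNr. Qed.

Lemma ip_sumr u n (v : 'I_n -> U) : ip u (\sum_(k < n) v k) = \sum_(k < n) ip u (v k).
Proof. exact: linear_sumr. Qed.

Lemma ip0r u : ip u 0 = 0.
Proof. exact: linear0r. Qed.

Lemma ipZl a u v : ip (a *: u) v = a * ip u v.
Proof. exact: linearZl_LR. Qed.

Lemma ipZr a u v : ip u (a *: v) = a * ip u v.
Proof. exact: linearZr_LR. Qed.

Lemma ip_ge0 u : 0 <= ip u u.
Proof.
have [->|u0] := eqVneq u 0; first by rewrite ip0r.
by rewrite ltW// neq0_dnorm_gt0.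
Qed.

Lemma ipBB u v : ip (u - v) (u - v) = ip u u - ip u v *+ 2 + ip v v.
Proof. by rewrite ipBl !ipBr (ipC v u); ring. Qed.

Lemma ip_projB u g : ip g g = 1 ->
  ip (u - ip u g *: g) (u - ip u g *: g) = ip u u - ip u g ^+ 2.
Proof. by move=> g1; rewrite ipBB ipZl !ipZr g1; ring. Qed.

Lemma cauchy_schwarz u v : ip u v ^+ 2 <= ip u u * ip v v.
Proof.
have [->|v0] := eqVneq v 0; first by rewrite !ip0r expr0n mulr0.
have vv := neq0_dnorm_gt0 (s := ip) v v0.
rewrite -ler_pdivrMr// -subr_ge0.
suff -> : ip u u - ip u v ^+ 2 / ip v v =
    ip (u - (ip u v / ip v v) *: v) (u - (ip u v / ip v v) *: v).
  exact: ip_ge0.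
by rewrite ipBB ipZl !ipZr; field; rewrite gt_eqF.
Qed.

Lemma ip_le_sqrt u v : `|ip u v| <= Num.sqrt (ip u u) * Num.sqrt (ip v v).
Proof.
by rewrite -sqrtrM ?ip_ge0// -sqrtr_sqr ler_wsqrtr// cauchy_schwarz.
Qed.

Lemma sqrt_ipD u v :
  Num.sqrt (ip (u + v) (u + v)) <= Num.sqrt (ip u u) + Num.sqrt (ip v v).
Proof.
rewrite -(ler_pXn2r (n := 2)) ?nnegrE ?addr_ge0 ?sqrtr_ge0//.
rewrite sqrrD !sqr_sqrtr ?ip_ge0// ipDl (ipC u (u + v)) (ipC v (u + v)) !ipDl.
have := ler_norm (ip u v); have := ip_le_sqrt u v.
rewrite (ipC v u); lra.
Qed.

End dot_theory.

(** * Hardy's inequality for finite sums *)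

Section finite_real.
Context {R : realFieldType}.

(* Hardy's inequality; the boundary term [2 * n%:R * a n ^+ 2] makes the induction go through. *)
Lemma hardy (a b : nat -> R) n :
  (forall m, m%:R * a m = \sum_(k < m) b k) ->
  \sum_(m < n) a m.+1 ^+ 2 + 2 * n%:R * a n ^+ 2 <= 4 * \sum_(k < n) b k ^+ 2.
Proof.
move=> aE; elim: n => [|n IH]; first by rewrite !big_ord0 mulr0 mul0r addr0 mulr0.
rewrite !big_ord_recr /= mulrDr.
suff : a n.+1 ^+ 2 + 2 * n.+1%:R * a n.+1 ^+ 2 <= 2 * n%:R * a n ^+ 2 + 4 * b n ^+ 2.
  by move: IH; lra.
have bE : b n = n.+1%:R * a n.+1 - n%:R * a n.
  by rewrite !aE big_ord_recr /= addrAC subrr add0r.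
rewrite bE -(natr1 n); set x := a n.+1; set y := a n; set m : R := n%:R.
have m0 : 0 <= m by rewrite ler0n.
rewrite -subr_ge0.
suff -> : 2 * m * y ^+ 2 + 4 * ((m + 1) * x - m * y) ^+ 2 -
    (x ^+ 2 + 2 * (m + 1) * x ^+ 2) =
   (2 * ((m + 1) * x - m * y) - x) ^+ 2 + 2 * m * (x - y) ^+ 2.
  by rewrite addr_ge0 ?sqr_ge0// mulr_ge0 ?sqr_ge0 ?mulr_ge0.
ring.
Qed.

End finite_real.

(** * Sufficiency *)

Section sufficiency.
Context {R : realType} {H : completeNormedModType R} {ip : {dot H for idfun}}.
Hypothesis Hip : hilbert_norm ip.
Implicit Types (D : set H) (r f g : H) (phi : nat -> H) (t : nat -> R).

Lemma normsqE r : `|r| ^+ 2 = ip r r.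
Proof. by rewrite Hip sqr_sqrtr// ip_ge0. Qed.

Lemma ip_le_norm r g : `|ip r g| <= `|r| * `|g|.
Proof. by rewrite !Hip ip_le_sqrt. Qed.

Lemma ub_ip_dictionary D r : dictionary D -> ubound [set `|ip r g| | g in D] `|r|.
Proof.
by move=> [D1 _] _ [g Dg <-]; rewrite (le_trans (ip_le_norm _ _))// (D1 g)// mulr1.
Qed.

Lemma ip_le_sup D r g : dictionary D -> D g ->
  `|ip r g| <= sup [set `|ip r g| | g in D].
Proof.
move=> dD Dg; apply: ub_le_sup; last by exists g.
by exists `|r|; exact: ub_ip_dictionary.
Qed.

(** The slab of all [y] with [|ip r y| <= s] is convex and contains [D] and its negatives, hence
    their convex hull; the closure is reached by approximation. *)
Lemma ip_A1_le_sup D r f : dictionary D -> D !=set0 -> A1 D f ->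
  `|ip r f| <= sup [set `|ip r g| | g in D].
Proof.
move=> dD [g0 Dg0]; set s := sup _ => A1f.
have s0 : 0 <= s by rewrite (le_trans _ (ip_le_sup D r g0 dD Dg0)).
have hull_le y : convex_hull (D `|` [set - g | g in D]) y -> `|ip r y| <= s.
  move=> /(_ [set y | `|ip r y| <= s]); apply; split=> /=.
    move=> x z l /set_mem/= xs /set_mem/= zs; apply/mem_set => /=.
    rewrite -[ip r _]/(ip r (l%:num *: (x : H) + (1 - l%:num) *: (z : H))).
    rewrite ipDr !ipZr.
    rewrite (le_trans (ler_normD _ _))// !normrM.
    have l0 : 0 <= l%:num by [].
    have l1 : 0 <= 1 - l%:num by rewrite subr_ge0.
    rewrite (ger0_norm l0) (ger0_norm l1).
    have := ler_wpM2l l0 xs; have := ler_wpM2l l1 zs; lra.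
  move=> x [Dx|[g Dg <-]]; first exact: ip_le_sup.
  by rewrite /= ipNr normrN; exact: ip_le_sup.
apply/ler_addgt0Pr => e e0.
(* Dividing by [|r| + 1] rather than [|r|] covers the case [r = 0]. *)
have r1 : 0 < `|r| + 1 by rewrite ltr_wpDl.
have [y [hy]] := A1f _ (nbhsx_ballx f (e / (`|r| + 1)) (divr_gt0 e0 r1)).
rewrite -ball_normE/= => fy.
rewrite -[f](subrK y) ipDr addrC.
rewrite (le_trans (ler_normD _ _))// lerD ?hull_le//.
rewrite (le_trans (ip_le_norm _ _))//.
rewrite (@le_trans _ _ ((`|r| + 1) * (e / (`|r| + 1))))//.
  by rewrite ler_pM// ?lerDl// ltW.
by rewrite mulrC divfK// gt_eqF.
Qed.

Section realization.
Context {D : set H} {t : nat -> R} {f : H} {phi : nat -> H}.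
Hypotheses (dD : dictionary D) (rea : wga_realization ip D t f phi).
Let r := residual ip f phi.

Lemma normsq_residualS m : `|r m.+1| ^+ 2 = `|r m| ^+ 2 - ip (r m) (phi m.+1) ^+ 2.
Proof.
have [Dp _] := rea m.+1 isT.
by rewrite !normsqE /= ip_projB -?normsqE ?(dD.1 _ Dp) ?expr1n.
Qed.

Lemma norm_residual_nincr : nonincreasing_seq (fun m => `|r m|).
Proof.
apply/nonincreasing_seqP => m.
rewrite -(ler_pXn2r (n := 2)) ?nnegrE// normsq_residualS.
by rewrite lerBlDr lerDl sqr_ge0.
Qed.

Lemma sum_ip_residual m :
  \sum_(k < m) ip (r k) (phi k.+1) ^+ 2 = `|f| ^+ 2 - `|r m| ^+ 2.
Proof.
elim: m => [|m IH]; first by rewrite big_ord0 subrr.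
by rewrite big_ord_recr /= IH normsq_residualS; ring.
Qed.

Lemma residualE m : r m = f - \sum_(k < m) ip (r k) (phi k.+1) *: phi k.+1.
Proof.
elim: m => [|m IH]; first by rewrite big_ord0 subr0.
by rewrite big_ord_recr /= opprD addrA -IH.
Qed.

(* Expand only one factor of [ip (r m) (r m)] along [r m = f - sum a_k phi_k]. *)
Lemma normsq_residual_le m : A1 D f ->
  `|r m| ^+ 2 <= sup [set `|ip (r m) g| | g in D] *
                 (1 + \sum_(k < m) `|ip (r k) (phi k.+1)|).
Proof.
move=> A1f; have D0 : D !=set0 by exists (phi 1%N); exact: (rea 1%N isT).1.
rewrite normsqE {2}residualE ipBr mulrDr mulr1.
apply: lerD; first by apply: (le_trans (ler_norm _)); exact: ip_A1_le_sup.
rewrite ip_sumr -sumrN mulr_sumr; apply: ler_sum => k _.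
apply: (le_trans (ler_norm _)); rewrite normrN ipZr normrM mulrC ler_wpM2r//.
by apply: ip_le_sup => //; exact: (rea k.+1 isT).1.
Qed.

(** With [a] the running means of [b], each term is at most a product [b * a <= (b^2 + a^2) / 2].
    The squares of [b] sum to at most [1 + |f|^2] and, by Hardy, those of [a] to at most four times
    this, whence the factor (1 + 4) / 2. *)
Lemma weakness_sum_le e N : (forall k, (0 < k)%N -> 0 <= t k) -> A1 D f ->
  (forall m, e <= `|r m| ^+ 2) ->
  e * \sum_(k < N) t k.+1 / k.+1%:R <= 5 / 2 * (1 + `|f| ^+ 2).
Proof.
move=> t0 A1f er.
(* The value [b 0 = 1] absorbs the summand 1 of [normsq_residual_le], so that its second factor is
   [m.+1%:R * a m.+1]. *)
pose b k := if k is k'.+1 then `|ip (r k') (phi k'.+1)| else 1.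
pose a m := (\sum_(k < m) b k) / m%:R.
have aE m : m%:R * a m = \sum_(k < m) b k.
  case: m => [|m]; first by rewrite big_ord0 mul0r.
  by rewrite /a mulrC divfK// pnatr_eq0.
have sumb n : \sum_(k < n) b k ^+ 2 <= 1 + `|f| ^+ 2.
  case: n => [|n]; first by rewrite big_ord0 addr_ge0// sqr_ge0.
  rewrite big_ord_recl /= expr1n lerD2l.
  under eq_bigr do rewrite real_normK ?num_real//.
  by rewrite sum_ip_residual lerBlDr lerDl sqr_ge0.
have := hardy a b N.+1 aE; rewrite big_ord_recl/= => hardyN.
have suma : \sum_(k < N) a k.+1 ^+ 2 <= 4 * (1 + `|f| ^+ 2).
  have := hardy a b N aE; have := sumb N.
  have : 0 <= 2 * N%:R * a N ^+ 2 by rewrite mulr_ge0 ?sqr_ge0// mulr_ge0.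
  lra.
have step m : e * (t m.+1 / m.+1%:R) <= (b m.+1 ^+ 2 + a m.+1 ^+ 2) / 2.
  have : e * t m.+1 <= b m.+1 * (m.+1%:R * a m.+1).
    rewrite aE big_ord_recl /=.
    apply: (@le_trans _ _ (t m.+1 * sup [set `|ip (r m) g| | g in D] *
                 (1 + \sum_(k < m) `|ip (r k) (phi k.+1)|))).
      by rewrite mulrC -mulrA ler_wpM2l ?t0// (le_trans (er m))// normsq_residual_le.
    rewrite ler_wpM2r//; last exact: (rea m.+1 isT).2.
    by rewrite addr_ge0// sumr_ge0.
  move=> le_t; rewrite mulrA ler_pdivrMr ?ltr0n//; apply: (le_trans le_t).
  rewrite mulrCA mulrC ler_wpM2r//.
  by rewrite -subr_ge0 (_ : _ - _ = (b m.+1 - a m.+1) ^+ 2 / 2);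
    [rewrite divr_ge0 ?sqr_ge0|field].
rewrite mulr_sumr (le_trans (ler_sum _ (fun (k : 'I_N) _ => step k)))//.
rewrite -mulr_suml big_split /=.
have := sumb N.+1; rewrite big_ord_recl /= expr1n; move: suma; lra.
Qed.

End realization.

Lemma A1_converges_of_divergence D t : dictionary D ->
  (forall k, (0 < k)%N -> 0 <= t k) ->
  (\sum_(1 <= k <oo) (t k / k%:R)%:E = +oo)%E -> A1_converges ip D t.
Proof.
move=> dD t0 tdiv f phi A1f rea.
apply/cvgrPdist_lt => e e0; apply/not_notP => far.
(* Residual norms never increase, so a single one below [e] would give convergence within [e]. *)
have er m : e ^+ 2 <= `|residual ip f phi m| ^+ 2.
  rewrite ler_pXn2r ?nnegrE ?(ltW e0)// leNgt; apply/negP => small.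
  apply: far; exists m => // n /= mn; rewrite sub0r normrN normr_id.
  exact: le_lt_trans (norm_residual_nincr dD rea _ _ mn) small.
have e20 : 0 < e ^+ 2 by rewrite exprn_gt0.
pose B := 5 / 2 * (1 + `|f| ^+ 2) / e ^+ 2.
suff : (\sum_(1 <= k <oo) (t k / k%:R)%:E <= B%:E)%E by rewrite tdiv leye_eq.
apply: lime_le.
  by apply: is_cvg_nneseries => k k0 _; rewrite lee_fin divr_ge0// t0.
near=> n.
rewrite sumEFin lee_fin big_add1 big_mkord /B ler_pdivlMr// mulrC.
exact: weakness_sum_le dD rea _ _ t0 A1f er.
Unshelve. all: by end_near.
Qed.

End sufficiency.

(** * The Hilbert space of square-summable sequences *)

Lemma series_ord {V : zmodType} (u : V ^nat) n : series u n = \sum_(k < n) u k.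
Proof. by rewrite seriesEord. Qed.

(** A boolean predicate, so that closure under linear combinations yields the module structure on
    the subtype. *)
Definition square_summable (R : realType) : {pred nat -> R} :=
  [pred u : nat -> R | `[< exists M, forall n, \sum_(k < n) u k ^+ 2 <= M >]].

Section square_summable.
Context {R : realType}.
Implicit Types u v : nat -> R.

Lemma square_summable_submod_closed : submod_closed (@square_summable R).
Proof.
split=> [|a u v /asboolP[M uM] /asboolP[N vN]]; apply/asboolP.
  by exists 0 => n; rewrite big1// => k _; rewrite expr0n.
exists (2 * (a ^+ 2 * M) + 2 * N) => n.
apply: (@le_trans _ _ (2 * (a ^+ 2 * \sum_(k < n) u k ^+ 2) + 2 * \sum_(k < n) v k ^+ 2)).
  rewrite !mulr_sumr -big_split/=; apply: ler_sum => k _.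
  rewrite -[(a *: u + v) _]/(a * u k + v k) -subr_ge0.
  rewrite (_ : _ - _ = (a * u k - v k) ^+ 2) ?sqr_ge0//; ring.
by rewrite lerD// ler_wpM2l// ler_wpM2l// sqr_ge0.
Qed.

HB.instance Definition _ :=
  GRing.isSubmodClosed.Build R (nat -> R) (@square_summable R) square_summable_submod_closed.

(** Absolute convergence, by [|x y| <= x^2 + y^2] termwise. *)
Lemma cvg_series_mul u v : u \in @square_summable R -> v \in @square_summable R ->
  cvgn (series (fun k => u k * v k)).
Proof.
move=> /asboolP[M uM] /asboolP[N vN]; apply: normed_cvg.
apply: nondecreasing_is_cvgn; first by apply: nondecreasing_series => k _ _; exact: normr_ge0.
exists (M + N) => _ [n _ <-]; rewrite /= series_ord.
rewrite (le_trans _ (lerD (uM n) (vN n)))// -big_split/=.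
apply: ler_sum => k _; rewrite normrM -subr_ge0.
rewrite -(real_normK (num_real (u k))) -(real_normK (num_real (v k))).
have := sqr_ge0 (`|u k| - `|v k|); have := normr_ge0 (u k); have := normr_ge0 (v k).
nra.
Qed.

End square_summable.

Record ell2 (R : realType) := Ell2 {
  ell2_val :> nat -> R ;
  ell2_valP : ell2_val \in @square_summable R }.
Arguments Ell2 {R}.

HB.instance Definition _ (R : realType) := [isSub for @ell2_val R].
HB.instance Definition _ (R : realType) := [Choice of ell2 R by <:].
HB.instance Definition _ (R : realType) := [SubChoice_isSubLmodule of ell2 R by <:].

Section ell2_dot.
Context {R : realType}.
Implicit Types u v w : ell2 R.

Lemma ell2_eq u v : u =1 v -> u = v.
Proof. by move=> uv; apply/val_inj/funext. Qed.

Lemma ell2DE u v k : (u + v) k = u k + v k. Proof. by []. Qed.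
Lemma ell2BE u v k : (u - v) k = u k - v k. Proof. by []. Qed.
Lemma ell2ZE a u k : (a *: u) k = a * u k. Proof. by []. Qed.

Definition ell2_dot u v := limn (series (fun k => u k * v k)).

Lemma cvg_ell2_dot u v : series (fun k => u k * v k) @ \oo --> ell2_dot u v.
Proof. by apply: cvg_series_mul; exact: ell2_valP. Qed.

Lemma ell2_dotC u v : ell2_dot u v = ell2_dot v u.
Proof. by congr (limn (series _)); apply/funext => k; rewrite mulrC. Qed.

Lemma ell2_dotPl w a u v : ell2_dot (a *: u + v) w = a * ell2_dot u w + ell2_dot v w.
Proof.
apply/cvg_lim => //.
rewrite (_ : series _ = (a *: series (fun k => u k * w k)) + series (fun k => v k * w k)).
  by apply: cvgD; [apply: cvgZr|]; exact: cvg_ell2_dot.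
rewrite -seriesZ -seriesD; congr series; apply/funext => k.
by rewrite ell2DE ell2ZE mulrDl -mulrA.
Qed.

Lemma ell2_dotPr w a u v : ell2_dot w (a *: u + v) = a * ell2_dot w u + ell2_dot w v.
Proof. by rewrite ell2_dotC ell2_dotPl !(ell2_dotC _ w). Qed.

Lemma sum_sqr_le_dot u n : \sum_(k < n) u k ^+ 2 <= ell2_dot u u.
Proof.
have nd : nondecreasing_seq (series (fun k => u k * u k)).
  by apply: nondecreasing_series => k _ _; rewrite -expr2 sqr_ge0.
by have := nondecreasing_cvgn_le nd (cvgP _ (cvg_ell2_dot u u)) n; rewrite series_ord.
Qed.

Lemma sqr_le_dot u k : u k ^+ 2 <= ell2_dot u u.
Proof.
rewrite (le_trans _ (sum_sqr_le_dot u k.+1))// big_ord_recr/= lerDr sumr_ge0// => i _.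
exact: sqr_ge0.
Qed.

Lemma ell2_dot_le u M : (forall n, \sum_(k < n) u k ^+ 2 <= M) -> ell2_dot u u <= M.
Proof.
move=> uM; apply: limr_le; first exact: cvgP (cvg_ell2_dot u u).
by near=> n; rewrite series_ord; exact: uM.
Unshelve. all: by end_near.
Qed.

Lemma ell2_dot_gt0 u : u != 0 -> 0 < ell2_dot u u.
Proof.
move=> u0; apply/contraT => dot0; case/eqP: u0; apply: ell2_eq => k.
rewrite -leNgt in dot0; have := le_trans (sqr_le_dot u k) dot0.
by rewrite le_eqVlt ltNge sqr_ge0 orbF sqrf_eq0 => /eqP.
Qed.

HB.instance Definition _ := bilinear_isBilinear.Build R (ell2 R) (ell2 R) R
  ( *%R) ( *%R) ell2_dot (ell2_dotPl, ell2_dotPr).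

End ell2_dot.

HB.instance Definition _ (R : realType) :=
  isHermitianSesquilinear.Build R (ell2 R) false idfun ell2_dot
    (fun u v => etrans (ell2_dotC u v) (esym (mul1r _))).
HB.instance Definition _ (R : realType) :=
  isDotProduct.Build R (ell2 R) ell2_dot (@ell2_dot_gt0 R).

Section ell2_norm.
Context {R : realType}.
Implicit Types u v w : ell2 R.

Let nm u := Num.sqrt (ell2_dot u u).

Lemma ell2_normZ a u : nm (a *: u) = `|a| * nm u.
Proof.
rewrite /nm (ipZl ell2_dot) (ipZr ell2_dot) mulrA -expr2 sqrtrM ?sqr_ge0//.
by rewrite sqrtr_sqr.
Qed.

Lemma ell2_norm_eq0 u : nm u = 0 -> u = 0.
Proof.
move=> /eqP; rewrite sqrtr_eq0 => u0; apply/eqP; apply: contraT => /ell2_dot_gt0.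
by rewrite ltNge u0.
Qed.

End ell2_norm.

HB.instance Definition _ (R : realType) :=
  @Lmodule_isNormed.Build R (ell2 R) (fun u => Num.sqrt (ell2_dot u u))
    (sqrt_ipD ell2_dot) ell2_normZ ell2_norm_eq0.

Section ell2_complete.
Context {R : realType}.
Implicit Types u v w : ell2 R.

Lemma ell2_normE u : `|u| = Num.sqrt (ell2_dot u u).
Proof. by []. Qed.

Lemma ell2_normsq u : `|u| ^+ 2 = ell2_dot u u.
Proof. by rewrite ell2_normE sqr_sqrtr// (ip_ge0 ell2_dot). Qed.

Lemma ell2_coord_le u k : `|u k| <= `|u|.
Proof.
rewrite -(ler_pXn2r (n := 2)) ?nnegrE// ell2_normsq real_normK ?num_real//.
exact: sqr_le_dot.
Qed.

(** Used to place the coordinatewise limit of a Cauchy filter in the space: it lies at finite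
    distance from a member. *)
Lemma ell2_sub_mem u (l : nat -> R) M :
  (forall n, \sum_(k < n) (u k - l k) ^+ 2 <= M) -> l \in @square_summable R.
Proof.
move=> uM; pose w : nat -> R := u; rewrite (_ : l = w - (w - l)).
  by apply: rpredB; [exact: ell2_valP|apply/asboolP; exists M].
by apply/funext => k; rewrite -[RHS]/(u k - (u k - l k)) subKr.
Qed.

(** Coordinates are 1-Lipschitz, so they converge along the filter. Bounds on finite sections pass
    to the limit uniformly in the length, which gives convergence in norm. *)
Lemma ell2_cauchy_cvg (F : set_system (ell2 R)) : ProperFilter F -> cauchy F -> cvg F.
Proof.
move=> FF /cauchyP Fc.
have coord k : exists l, (fun v : ell2 R => v k) @ F --> (l : R).
  apply/cvg_ex; apply: cauchy_cvg; apply/cauchyP => e e0.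
  have [x Fx] := Fc e e0; exists (x k).
  apply: (@filterS _ F _ _ _ _ Fx) => v; rewrite -ball_normE/= => xv.
  suff : `|x k - v k| < e by rewrite -ball_normE.
  exact: le_lt_trans (ell2_coord_le (x - v) k) xv.
pose l k := xget 0 [set l : R | (fun v : ell2 R => v k) @ F --> l].
have lP k : (fun v : ell2 R => v k) @ F --> l k.
  by apply: (@xgetPex _ 0 [set l : R | (fun v : ell2 R => v k) @ F --> l]); exact: coord.
(* If the ball of radius [e] at [x] belongs to the filter, the coordinatewise limit is within [e] of
   [x]. *)
have lsum e x : 0 < e -> F (ball x e) ->
    forall n, \sum_(k < n) (x k - l k) ^+ 2 <= e ^+ 2.
  move=> e0 Fx n.
  have : (fun v : ell2 R => \sum_(k < n) (x k - v k) ^+ 2) @ F -->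
         \sum_(k < n) (x k - l k) ^+ 2.
    apply: cvg_big => [|k _]; first by move=> z; exact: add_continuous.
    have cvk : (fun v : ell2 R => x k - v k) @ F --> x k - l k.
      by apply: cvgB => //; exact: cvg_cst.
    exact: (cvgM cvk cvk).
  move=> /cvgr_to_le; apply.
  apply: filterS Fx => v; rewrite -ball_normE/= => xv.
  rewrite (le_trans (sum_sqr_le_dot (x - v) n))// -ell2_normsq.
  by rewrite ler_pXn2r ?nnegrE ?(ltW e0)// ltW.
have [x1 Fx1] := Fc 1 ltr01.
pose L := Ell2 l (ell2_sub_mem _ _ _ (lsum 1 x1 ltr01 Fx1)).
apply/cvg_ex; exists L; apply/fcvgrPdist_lt => e e0.
have e20 : 0 < e / 2 by rewrite divr_gt0.
have [x Fx] := Fc _ e20.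
have xL : `|L - x| <= e / 2.
  rewrite distrC -(ler_pXn2r (n := 2)) ?nnegrE ?(ltW e20)// ell2_normsq.
  by apply: ell2_dot_le; exact: (lsum _ _ e20 Fx).
apply: filterS Fx => v; rewrite -ball_normE/= => xv.
rewrite [e]splitr (le_lt_trans (ler_distD x L v))//.
exact: ler_ltD.
Qed.

HB.instance Definition _ := Uniform_isComplete.Build (ell2 R) ell2_cauchy_cvg.

End ell2_complete.

Lemma ell2_hilbert (R : realType) :
  @hilbert_norm R (ell2 R) (ell2_dot : {dot (ell2 R) for idfun}).
Proof. by []. Qed.

(** * Splitting one coordinate into two *)

(* [d_k = (n - k) e + k (e' + e'')] for [0 <= k <= n] goes from [n e] to [n (e' + e'')];
   projecting successively on the lines spanned by [d_1, ..., d_n], [e] becomes [mu k d_k]. *)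
Section rotation.
Context {R : rcfType} (n : nat).
Implicit Types k : nat.

(** The squared norm of [d_k]. *)
Definition rot_normsq k : R := (n%:R - k%:R) ^+ 2 + 2 * k%:R ^+ 2.

(** The inner product of [d_k] and [d_(k+1)]; divided by the squared norm of [d_(k+1)] it is the
    factor gained by [mu] in one projection. *)
Definition rot_dot k : R := (n%:R - k%:R) * (n%:R - k.+1%:R) + 2 * (k%:R * k.+1%:R).

Fixpoint mu k : R :=
  if k is k'.+1 then mu k' * (rot_dot k' / rot_normsq k) else n%:R^-1.

(* Unit vector [rot_sin k e - rot_cos k (e' + e'')] orthogonal to [d_k]. *)
Definition rot_sin k : R := 2 * k%:R / Num.sqrt (2 * rot_normsq k).
Definition rot_cos k : R := (n%:R - k%:R) / Num.sqrt (2 * rot_normsq k).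

(** The inner product of [mu k d_k] with the unit normal to [d_(k+1)], simplified by 2(k+1)(n-k) -
    2(n-k-1)k = 2n. *)
Definition rot_coef k : R := 2 * n%:R * mu k / Num.sqrt (2 * rot_normsq k.+1).

(** The squared norm of [mu k d_k]. *)
Definition rot_mass k : R := mu k ^+ 2 * rot_normsq k.

Hypothesis n_gt0 : (0 < n)%N.

Let n0 : 0 < n%:R :> R. Proof. by rewrite ltr0n. Qed.

(** The quadratic is smallest at k = n/3. *)
Lemma rot_normsq_ge k : 2 / 3 * n%:R ^+ 2 <= rot_normsq k.
Proof.
rewrite -subr_ge0 (_ : _ - _ = (n%:R - 3 * k%:R) ^+ 2 / 3).
  by rewrite divr_ge0 ?sqr_ge0.
by rewrite /rot_normsq; field.
Qed.

Lemma rot_normsq_gt0 k : 0 < rot_normsq k.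
Proof. by apply: lt_le_trans (rot_normsq_ge k); rewrite mulr_gt0// exprn_gt0. Qed.

Lemma rot_normsq_le k : (k <= n)%N -> rot_normsq k <= 2 * n%:R ^+ 2.
Proof.
rewrite -(ler_nat R) => kn; have k0 : 0 <= k%:R :> R by rewrite ler0n.
rewrite /rot_normsq; nra.
Qed.

Lemma rot_dot_ge0 k : (k < n)%N -> 0 <= rot_dot k.
Proof.
move=> kn; rewrite addr_ge0 ?mulr_ge0// subr_ge0 ler_nat //; exact: ltnW.
Qed.

Lemma rot_sqrt_neq0 k : Num.sqrt (2 * rot_normsq k) != 0.
Proof. by rewrite sqrtr_eq0 -ltNge mulr_gt0// rot_normsq_gt0. Qed.

Lemma rot_sqrtK k : Num.sqrt (2 * rot_normsq k) ^+ 2 = 2 * rot_normsq k.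
Proof. by rewrite sqr_sqrtr// mulr_ge0// ltW// rot_normsq_gt0. Qed.

Lemma rot_unit k : rot_sin k ^+ 2 + 2 * rot_cos k ^+ 2 = 1.
Proof.
rewrite /rot_sin /rot_cos !expr_div_n rot_sqrtK /rot_normsq.
by field; rewrite gt_eqF// rot_normsq_gt0.
Qed.

Lemma rot_sin_ge0 k : 0 <= rot_sin k.
Proof. by rewrite divr_ge0 ?sqrtr_ge0// mulr_ge0. Qed.

Lemma rot_cos_ge0 k : (k <= n)%N -> 0 <= rot_cos k.
Proof. by move=> kn; rewrite divr_ge0 ?sqrtr_ge0// subr_ge0 ler_nat. Qed.

Lemma rot_coefE k :
  rot_sin k.+1 * (mu k * (n%:R - k%:R)) - 2 * rot_cos k.+1 * (mu k * k%:R) = rot_coef k.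
Proof.
rewrite /rot_coef /rot_sin /rot_cos; move: (rot_sqrt_neq0 k.+1).
by move: (Num.sqrt _) => D D0; rewrite -(natr1 k); field.
Qed.

(** Removing the component along the unit normal to [d_(k+1)] leaves [mu k.+1 d_(k+1)]. This is the
    coordinate on [e]; [rot_coef_cos] gives the common coordinate on [e'] and [e'']. *)
Lemma rot_coef_sin k :
  mu k * (n%:R - k%:R) - rot_coef k * rot_sin k.+1 = mu k.+1 * (n%:R - k.+1%:R).
Proof.
rewrite /rot_coef /rot_sin mulrACA -invfM -expr2 rot_sqrtK /=.
have := rot_normsq_gt0 k.+1; rewrite /rot_dot /rot_normsq -(natr1 k) => nz.
by field; rewrite gt_eqF.
Qed.

Lemma rot_coef_cos k :
  mu k * k%:R + rot_coef k * rot_cos k.+1 = mu k.+1 * k.+1%:R.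
Proof.
rewrite /rot_coef /rot_cos mulrACA -invfM -expr2 rot_sqrtK /=.
have := rot_normsq_gt0 k.+1; rewrite /rot_dot /rot_normsq -(natr1 k) => nz.
by field; rewrite gt_eqF.
Qed.

Lemma mu_ge0 k : (k <= n)%N -> 0 <= mu k.
Proof.
elim: k => [|k IH] kn /=; first by rewrite invr_ge0 ltW.
rewrite mulr_ge0 ?IH ?(ltnW kn)// divr_ge0 ?rot_dot_ge0//.
by rewrite ltW// rot_normsq_gt0.
Qed.

Lemma rot_mass0 : rot_mass 0 = 1.
Proof. by rewrite /rot_mass /rot_normsq /=; field; rewrite gt_eqF. Qed.

Lemma rot_coef_sqr k : rot_coef k ^+ 2 = 2 * n%:R ^+ 2 * mu k ^+ 2 / rot_normsq k.+1.
Proof.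
rewrite /rot_coef expr_div_n rot_sqrtK.
by field; rewrite gt_eqF// rot_normsq_gt0.
Qed.

Lemma rot_massS k : rot_mass k.+1 = rot_mass k - rot_coef k ^+ 2.
Proof.
rewrite rot_coef_sqr /rot_mass /=.
have := rot_normsq_gt0 k.+1; rewrite /rot_dot /rot_normsq -(natr1 k) => nz.
by field; rewrite gt_eqF.
Qed.

Lemma rot_mass_le1 k : rot_mass k <= 1.
Proof.
elim: k => [|k IH]; first by rewrite rot_mass0.
by rewrite rot_massS (le_trans _ IH)// gerBl sqr_ge0.
Qed.

(** Both [mu k ^+ 2] and the inverse of [rot_normsq k.+1] are at most 3 / (2 n^2), the former
    because the mass is at most 1. *)
Lemma rot_coef_sqr_le k : rot_coef k ^+ 2 <= 9 / 2 / n%:R ^+ 2.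
Proof.
have n20 : 0 < n%:R ^+ 2 :> R by rewrite exprn_gt0.
rewrite rot_coef_sqr ler_pdivrMr ?rot_normsq_gt0//.
apply: (@le_trans _ _ 3).
  have := rot_mass_le1 k; rewrite /rot_mass.
  have := ler_wpM2l (sqr_ge0 (mu k)) (rot_normsq_ge k); lra.
rewrite -[leLHS](_ : 9 / 2 / n%:R ^+ 2 * (2 / 3 * n%:R ^+ 2) = 3).
  by rewrite ler_wpM2l ?rot_normsq_ge// divr_ge0// ltW.
by field; rewrite gt_eqF.
Qed.

Hypothesis n_ge9 : (9 <= n)%N.

(** At most n rotations, each losing at most 9 / (2 n^2), lose at most 9 / (2 n), which is at most
    1/2 once n >= 9. *)
Lemma rot_mass_ge k : (k <= n)%N -> 2^-1 <= rot_mass k.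
Proof.
move=> kn; have n9 : 9 <= n%:R :> R by rewrite (ler_nat _ 9).
have kn' : k%:R <= n%:R :> R by rewrite ler_nat.
have n20 : 0 < n%:R ^+ 2 :> R by rewrite exprn_gt0.
suff : 1 - k%:R * (9 / 2 / n%:R ^+ 2) <= rot_mass k.
  apply: le_trans; rewrite lerBrDr -lerBrDl mulrA ler_pdivrMr//.
  by rewrite expr2; nra.
elim: k {kn kn'} => [|k IH]; first by rewrite rot_mass0 mul0r subr0.
rewrite rot_massS -natr1; have := rot_coef_sqr_le k; move: IH; lra.
Qed.

(** The lower bound that makes each rotation an admissible greedy step: half of the mass survives
    and no [d_k] has squared norm above 2 n^2. *)
Lemma rot_coef_ge k : (k < n)%N -> (2 * n%:R)^-1 <= rot_coef k.
Proof.
move=> kn; have c0 : 0 <= rot_coef k.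
  by rewrite divr_ge0 ?sqrtr_ge0// !mulr_ge0// mu_ge0// ltnW.
have i0 : 0 <= (2 * n%:R)^-1 :> R by rewrite invr_ge0 mulr_ge0.
rewrite -(ler_pXn2r (n := 2)) ?nnegrE// rot_coef_sqr.
rewrite ler_pdivlMr ?rot_normsq_gt0//.
apply: (@le_trans _ _ (2^-1)).
  rewrite -[leRHS](_ : (2 * n%:R)^-1 ^+ 2 * (2 * n%:R ^+ 2) = 2^-1).
    by rewrite ler_wpM2l ?sqr_ge0// rot_normsq_le.
  by field; rewrite gt_eqF.
apply: (le_trans (rot_mass_ge k (ltnW kn))); rewrite /rot_mass mulrC.
by rewrite ler_wpM2r ?sqr_ge0// rot_normsq_le// ltnW.
Qed.

Lemma mu_coord1_le1 k : mu k * (n%:R - k%:R) <= 1.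
Proof.
apply: le_trans (ler_norm _) _; rewrite -(expr_le1 (n := 2))// real_normK ?num_real//.
apply: le_trans (rot_mass_le1 k).
by rewrite exprMn /rot_mass ler_wpM2l ?sqr_ge0// lerDl mulr_ge0// sqr_ge0.
Qed.

Lemma mu_coord2_le1 k : mu k * k%:R <= 1.
Proof.
apply: le_trans (ler_norm _) _; rewrite -(expr_le1 (n := 2))// real_normK ?num_real//.
apply: le_trans (rot_mass_le1 k).
rewrite exprMn /rot_mass ler_wpM2l ?sqr_ge0//.
have := sqr_ge0 (n%:R - k%:R : R); have := sqr_ge0 (k%:R : R); rewrite /rot_normsq; lra.
Qed.

(** The coordinate that each of [e'] and [e''] finally receives from a unit coordinate on [e]. *)
Definition split_ratio : R := mu n * n%:R.

Lemma split_ratio_sqr_le : split_ratio ^+ 2 <= 2^-1.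
Proof.
have := rot_mass_le1 n; rewrite /rot_mass /rot_normsq subrr expr0n /= add0r.
rewrite /split_ratio exprMn; lra.
Qed.

Lemma split_ratio_gt0 : 0 < split_ratio.
Proof.
rewrite lt_neqAle mulr_ge0 ?mu_ge0// andbT eq_sym -sqrf_eq0 gt_eqF//.
have := rot_mass_ge n (leqnn n); rewrite /rot_mass /rot_normsq subrr expr0n /= add0r.
rewrite /split_ratio exprMn; lra.
Qed.

End rotation.

(** * A greedy expansion along the binary tree *)

Section split_dictionary.
Context {R : realType}.
Implicit Types (u : ell2 R) (s c : R) (i j k : nat).

Let ip : {dot (ell2 R) for idfun} := ell2_dot.

Lemma std_basis_subproof i : (fun k => (k == i)%:R) \in @square_summable R.
Proof.
apply/asboolP; exists 1 => n; have [lt_in|le_ni] := ltnP i n.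
  rewrite (bigD1 (Ordinal lt_in))//= eqxx expr1n big1 ?addr0// => k ki.
  by rewrite (_ : (nat_of_ord k == i) = false) ?expr0n//; apply/negbTE.
rewrite big1// => k _.
by rewrite (_ : (nat_of_ord k == i) = false) ?expr0n// ltn_eqF// (leq_trans (ltn_ord k)).
Qed.

Definition std_basis i : ell2 R := Ell2 _ (std_basis_subproof i).

Lemma std_basisE i k : std_basis i k = (k == i)%:R. Proof. by []. Qed.

Lemma dot_std_basis u i : ell2_dot u (std_basis i) = u i.
Proof.
apply/cvg_lim => //; apply: cvg_near_cst; exists i.+1 => // n /= lt_in.
rewrite series_ord (bigD1 (Ordinal lt_in))//= eqxx mulr1 big1 ?addr0// => k ki.
by rewrite (_ : (nat_of_ord k == i) = false) ?mulr0//; apply/negbTE.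
Qed.

Lemma std_basis_norm i : `|std_basis i| = 1.
Proof. by rewrite ell2_normE dot_std_basis std_basisE eqxx sqrtr1. Qed.

Lemma sum_std_basisE (w : nat -> R) n k :
  (\sum_(i < n) w i *: std_basis i) k = if (k < n)%N then w k else 0.
Proof.
elim: n => [|n IH]; first by rewrite big_ord0.
rewrite big_ord_recr ell2DE [X in X + _]IH ell2ZE std_basisE ltnS [in RHS]leq_eqVlt.
by case: ltngtP => /= [_|_|->]; rewrite ?(mulr0, mulr1, addr0, add0r).
Qed.

(** Nodes of the binary tree are numbered breadth-first from 0, so the children of [j] are [2j+1]
    and [2j+2]. *)
Definition split_vec j s c : ell2 R :=
  s *: std_basis j - c *: (std_basis j.*2.+1 + std_basis j.*2.+2).

Lemma split_vecE j s c i : split_vec j s c i =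
  s * (i == j)%:R - c * ((i == j.*2.+1)%:R + (i == j.*2.+2)%:R).
Proof. by []. Qed.

Lemma dot_split_vec u j s c :
  ell2_dot u (split_vec j s c) = s * u j - c * (u j.*2.+1 + u j.*2.+2).
Proof. by rewrite -/(ip _ _) ipBr !ipZr ipDr /ip /= !dot_std_basis. Qed.

Lemma split_vec_norm j s c : s ^+ 2 + 2 * c ^+ 2 = 1 -> `|split_vec j s c| = 1.
Proof.
move=> sc1; rewrite ell2_normE dot_split_vec !split_vecE !eqxx.
rewrite (_ : (j == j.*2.+1) = false); last by apply/eqP; lia.
rewrite (_ : (j == j.*2.+2) = false); last by apply/eqP; lia.
rewrite (_ : (j.*2.+1 == j) = false); last by apply/eqP; lia.
rewrite (_ : (j.*2.+2 == j) = false); last by apply/eqP; lia.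
rewrite (_ : (j.*2.+1 == j.*2.+2) = false); last by apply/eqP; lia.
rewrite (_ : (j.*2.+2 == j.*2.+1) = false); last by apply/eqP; lia.
rewrite (_ : _ - _ = s ^+ 2 + 2 * c ^+ 2); first by rewrite sc1 sqrtr1.
by rewrite /=; ring.
Qed.

(** All nonnegative unit pairs [s], [c] are allowed, so the dictionary depends on [j0] alone and not
    on the numbers of rotations. *)
Definition split_dictionary j0 : set (ell2 R) := range std_basis `|`
  [set g | exists j s c, [/\ (j0 <= j)%N, 0 <= s, 0 <= c,
    s ^+ 2 + 2 * c ^+ 2 = 1 & g = split_vec j s c]].

(** Truncations are dense: the squared distance from [u] to its truncation [S] is a tail of the
    series of [ell2_dot u u]. *)
Lemma dictionary_of_std_basis (D : set (ell2 R)) :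
  (forall g, D g -> `|g| = 1) -> range std_basis `<=` D -> dictionary D.
Proof.
move=> D1 bD; split => //; apply/seteqP; split=> // u _ A /nbhs_ballP[e /= e0 eA].
have /cvgrPdist_lt/(_ (e ^+ 2)) := cvg_ell2_dot u u; rewrite exprn_gt0// => /(_ isT).
move=> [n _ /(_ n (leqnn n))/=]; rewrite series_ord => tail.
exists (\sum_(i < n) u i *: std_basis i); split.
  by exists n, (fun i => u i), (fun i => std_basis i); split=> // i; apply: bD; exists (val i).
apply: eA; rewrite -ball_normE/= -(ltr_pXn2r (n := 2)) ?nnegrE ?(ltW e0)//.
set S := \sum_(i < n) _.
have dotS v : ip v S = \sum_(k < n) u k * v k.
  by rewrite ip_sumr; apply: eq_bigr => k _; rewrite ipZr /ip /= dot_std_basis.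
rewrite ell2_normsq -/(ip _ _) ipBB !dotS.
rewrite [X in _ + X](eq_bigr (fun k : 'I_n => u k * u k)) => [|k _]; last first.
  by rewrite sum_std_basisE ltn_ord.
by apply: (le_lt_trans _ tail); apply: (le_trans _ (ler_norm _)); rewrite /ip /=; lra.
Qed.

Lemma dictionary_split j0 : dictionary (split_dictionary j0).
Proof.
apply: dictionary_of_std_basis => [g [[i _ <-]|[j [s [c [_ _ _ sc1 ->]]]]]|g gb].
- exact: std_basis_norm.
- exact: split_vec_norm.
- by left.
Qed.

(** For nonnegative coordinates, [s x] and [c (y + z)] enter a split vector with opposite signs, so
    it suffices to bound each by [M]; the factor 2 serves for [y + z]. *)
Lemma sup_split_le j0 u M : (forall i, 0 <= u i <= M) ->
  (forall i, (j0 <= i)%N -> 2 * u i <= M) ->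
  sup [set `|ip u g| | g in split_dictionary j0] <= M.
Proof.
move=> uM uM2; apply: ge_sup.
  by exists `|ip u (std_basis 0)|, (std_basis 0) => //; left; exists 0%N.
move=> _ [g [[i _ <-]|[j [s [c [j0j s0 c0 sc1 ->]]]]] <-].
  by rewrite /ip /= dot_std_basis ger0_norm; have /andP[] := uM i.
have jp : (j0 <= j.*2.+1)%N by lia.
have jq : (j0 <= j.*2.+2)%N by lia.
have := uM2 _ j0j; have := uM2 _ jp; have := uM2 _ jq.
have /andP[+ _] := uM j; have /andP[+ _] := uM j.*2.+1; have /andP[+ _] := uM j.*2.+2.
rewrite /ip /= dot_split_vec; move: (u j) (u _) (u _) => x y z z0 y0 x0 z1 y1 x1.
have s1 : s <= 1 by nra.
have c1 : c <= 1 by nra.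
by rewrite ler_norml; apply/andP; split; nra.
Qed.

End split_dictionary.

Lemma convex_set_average (R : realType) (V : lmodType R) (C : set V) (y : nat -> V) n :
  @convex_set R V C -> (forall i, C (y i)) ->
  C (n.+1%:R^-1 *: \sum_(i < n.+1) y i).
Proof.
move=> cC Cy; elim: n => [|n IH]; first by rewrite big_ord1 invr1 scale1r.
have n20 : n.+2%:R != 0 :> R by rewrite pnatr_eq0.
have n10 : n.+1%:R != 0 :> R by rewrite pnatr_eq0.
have l0 : 0 <= n.+1%:R / n.+2%:R :> R by rewrite divr_ge0.
have l1 : n.+1%:R / n.+2%:R <= 1 :> R by rewrite ler_pdivrMr ?mul1r ?ler_nat ?ltr0n.
have := cC _ _ (Itv01 l0 l1) (mem_set IH) (mem_set (Cy n.+1)) => /set_mem.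
rewrite -[conv _ _ _]/((n.+1%:R / n.+2%:R) *: (n.+1%:R^-1 *: \sum_(i < n.+1) y i) +
  (1 - n.+1%:R / n.+2%:R) *: y n.+1).
rewrite scalerA mulrAC divff// mul1r (_ : 1 - _ = n.+2%:R^-1).
  by rewrite -scalerDr [in X in _ -> X]big_ord_recr.
by rewrite -(natr1 n.+1) in n20 *; field.
Qed.

(** * The greedy realization that splits the nodes one after another *)

Section splitting.
(** [X j] is the coordinate of node [j] when its splitting starts and [N j] its number of rotations.
    The hypothesis [sum_XN] limits the total loss to half the initial mass of the [j0 + 1] nodes
    from [j0] to [2 j0]. *)
Context {R : realType} (t : nat -> R) (j0 : nat) (N : nat -> nat) (X : nat -> R) (c : R).

Let ip : {dot (ell2 R) for idfun} := ell2_dot.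

Hypothesis t_ge0 : forall m, (0 < m)%N -> 0 <= t m.
Hypothesis t_le1 : forall m, (0 < m)%N -> t m <= 1.
Hypothesis cE : c = (2 * j0.*2.+1%:R)^-1.
Hypothesis X0 : forall i, (j0 <= i <= j0.*2)%N -> X i = c.
Hypothesis X_split1 : forall j, (j0 <= j)%N -> X j.*2.+1 = X j * split_ratio (N j).
Hypothesis X_split2 : forall j, (j0 <= j)%N -> X j.*2.+2 = X j * split_ratio (N j).
Hypothesis X_gt0 : forall i, (j0 <= i)%N -> 0 < X i.
Hypothesis X_nincr : forall i j, (j0 <= i <= j)%N -> X j <= X i.
Hypothesis N_ge9 : forall j, (j0 <= j)%N -> (9 <= N j)%N.
Hypothesis t_le_N : forall j m, (j0 <= j < m)%N -> 4 * (N j)%:R * t m <= 1.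
Hypothesis sum_XN : forall n,
  \sum_(j0 <= i < n) 9 / 2 * X i ^+ 2 / (N i)%:R <= j0.+1%:R * c ^+ 2 / 2.

(* At [(j, k)] the node [j] is being split, and [k] of its [N j] rotations are done. *)
Definition split_coef (st : nat * nat) (i : nat) : R :=
  let: (j, k) := st in
  if i == j then X j * (mu (N j) k * ((N j)%:R - k%:R))
  else if (i == j.*2.+1) || (i == j.*2.+2) then X j * (mu (N j) k * k%:R)
  else if (j < i <= j.*2)%N then X i else 0.

Definition split_next (st : nat * nat) : nat * nat :=
  let: (j, k) := st in if (k.+1 < N j)%N then (j, k.+1) else (j.+1, 0%N).

Definition split_state n : nat * nat := iter n split_next (j0, 0%N).

Definition split_dir (st : nat * nat) : ell2 R :=
  split_vec st.1 (rot_sin (N st.1) st.2.+1) (rot_cos (N st.1) st.2.+1).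

(** Steps count from 1: step [m <= j0] removes coordinate [m - 1], and step [j0 + n + 1] performs
    the rotation of state [n]. *)
Definition split_choice m : ell2 R :=
  if (m <= j0)%N then std_basis m.-1 else split_dir (split_state (m - j0).-1).

(* The nodes [i < j0] only serve to absorb the first [j0] steps, where [t] need not be small. *)
Definition split_start_coef i : R := if (i < j0)%N then 2 * c else c.

Definition split_start : ell2 R := \sum_(i < j0.*2.+1) split_start_coef i *: std_basis i.

Let r := residual ip split_start split_choice.

Lemma c_gt0 : 0 < c.
Proof. by rewrite cE invr_gt0 mulr_gt0. Qed.

Lemma split_startE i :
  split_start i = if (i < j0)%N then 2 * c else if (i <= j0.*2)%N then c else 0.
Proof.
rewrite sum_std_basisE /split_start_coef ltnS; case: ifPn; case: ifPn => //; lia.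
Qed.

(** The start is the mean of [2 j0 + 1] points of the hull: [e_i] for [i < j0] and [e_i / 2], which
    is 3/4 of [e_i] plus 1/4 of [- e_i], for the others. *)
Lemma A1_split_start : A1 (split_dictionary j0) split_start.
Proof.
apply: subset_closure => C [cC AC].
pose y i : ell2 R := if (i < j0)%N then std_basis i else 2^-1 *: std_basis i.
rewrite (_ : split_start = j0.*2.+1%:R^-1 *: \sum_(i < j0.*2.+1) y i).
  apply: convex_set_average => // i.
  have Cp : C (std_basis i) by apply: AC; left; left; exists i.
  have Cn : C (- std_basis i) by apply: AC; right; exists (std_basis i) => //; left; exists i.
  rewrite /y; case: ifPn => // _.
  have l0 : 0 <= 3 / 4 :> R by [].
  have l1 : 3 / 4 <= 1 :> R by lra.
  have := cC _ _ (Itv01 l0 l1) (mem_set Cp) (mem_set Cn) => /set_mem.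
  rewrite -[conv _ _ _]/((3 / 4) *: std_basis i + (1 - 3 / 4) *: - std_basis i).
  by rewrite scalerN -scalerBl (_ : 3 / 4 - _ = 2^-1)//; field.
rewrite /split_start scaler_sumr; apply: eq_bigr => i _.
rewrite /split_start_coef /y cE invfM; case: ifPn => _.
  by rewrite mulrA divff// mul1r.
by rewrite scalerA mulrC.
Qed.

(** The middle bound keeps the node index below the step number, as [t_le_N] requires. *)
Lemma split_stateP n : let st := split_state n in
  [/\ (j0 <= st.1)%N, (st.1 <= j0 + n)%N & (st.2 < N st.1)%N].
Proof.
elim: n => [|n] /=; first by split=> //; [lia|exact: leq_trans (N_ge9 _ (leqnn _))].
rewrite -/(split_state n); case: (split_state n) => j k /= [j0j jn kN].
case: ifPn => /= kN'; first by split=> //; lia.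
by split; [lia|lia|apply: leq_trans (N_ge9 _ _) => //; lia].
Qed.

Lemma split_coef_ge0 j k i : (j0 <= j)%N -> (k <= N j)%N -> 0 <= split_coef (j, k) i <= X j.
Proof.
move=> j0j kN; have N0 : (0 < N j)%N by exact: leq_trans (N_ge9 _ j0j).
have Xj := X_gt0 _ j0j; rewrite /split_coef.
have kN' : 0 <= (N j)%:R - k%:R :> R by rewrite subr_ge0 ler_nat.
case: ifPn => _.
  apply/andP; split; first by rewrite mulr_ge0 ?(ltW Xj)// mulr_ge0 ?mu_ge0.
  by rewrite -[leRHS]mulr1 ler_wpM2l ?(ltW Xj)// mu_coord1_le1.
case: ifPn => _.
  apply/andP; split; first by rewrite mulr_ge0 ?(ltW Xj)// mulr_ge0 ?mu_ge0.
  by rewrite -[leRHS]mulr1 ler_wpM2l ?(ltW Xj)// mu_coord2_le1.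
case: ifPn => [/andP[ji _]|_]; last by rewrite lexx (ltW Xj).
by rewrite (ltW (X_gt0 _ _)) ?X_nincr//; lia.
Qed.

(** After the last rotation node [j] is empty and its children hold their values of [X]; the
    occupied nodes move from [j], ..., [2j] to [j+1], ..., [2j+2]. *)
Lemma split_coef_end j : (j0 <= j)%N -> split_coef (j, N j) =1 split_coef (j.+1, 0%N).
Proof.
move=> j0j i; rewrite /split_coef subrr mulr0n subr0 !mulr0.
have N0 : (0 < N j.+1)%N by apply: leq_trans (N_ge9 _ _) => //; lia.
rewrite [mu (N j.+1) 0]/= mulVf ?pnatr_eq0 -?lt0n// mulr1.
rewrite -/(split_ratio (N j)).
have [->|ij] := eqVneq i j.
  by do ?case: ifPn => //; lia.
have [/= /orP ic|inc] := boolP ((i == j.*2.+1) || (i == j.*2.+2)).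
  have -> : X j * split_ratio (N j) = X i.
    by case: ic => /eqP->; rewrite ?X_split1 ?X_split2.
  have [->//|ij1] := eqVneq i j.+1.
  do ?case: ifPn => //; lia.
have [ij1|ij1] := eqVneq i j.+1.
  by rewrite ij1; case: ifPn => //; lia.
do ?case: ifPn => //; lia.
Qed.

Lemma dot_split_dir j k (u : ell2 R) : (j0 <= j)%N -> u =1 split_coef (j, k) ->
  ell2_dot u (split_dir (j, k)) = X j * rot_coef (N j) k.
Proof.
move=> j0j uE; have N0 : (0 < N j)%N by exact: leq_trans (N_ge9 _ j0j).
rewrite dot_split_vec !uE /= !eqxx /= orbT.
rewrite (_ : (j.*2.+1 == j) = false); last by apply/eqP; lia.
rewrite (_ : (j.*2.+2 == j) = false); last by apply/eqP; lia.
by rewrite -(rot_coefE _ N0); ring.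
Qed.

Lemma split_step j k (u : ell2 R) : (j0 <= j)%N -> (k < N j)%N -> u =1 split_coef (j, k) ->
  u - ell2_dot u (split_dir (j, k)) *: split_dir (j, k) =1 split_coef (split_next (j, k)).
Proof.
move=> j0j kN uE i; have N0 : (0 < N j)%N by exact: leq_trans (N_ge9 _ j0j).
have -> : split_coef (split_next (j, k)) i = split_coef (j, k.+1) i.
  rewrite /split_next; case: ifPn => // kN'.
  by rewrite (_ : k.+1 = N j) ?split_coef_end//; lia.
rewrite dot_split_dir// ell2BE ell2ZE uE split_vecE /split_coef /=.
have [->|ij] := eqVneq i j.
  rewrite (_ : (j == j.*2.+1) = false); last by apply/eqP; lia.
  rewrite (_ : (j == j.*2.+2) = false); last by apply/eqP; lia.
  by rewrite -rot_coef_sin//=; ring.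
have [->|i1] := eqVneq i j.*2.+1.
  rewrite (_ : (j.*2.+1 == j.*2.+2) = false) /=; last by apply/eqP; lia.
  by rewrite -rot_coef_cos//=; ring.
have [->|i2] := eqVneq i j.*2.+2 => /=; last by ring.
by rewrite -rot_coef_cos//=; ring.
Qed.

Let rS m : r m.+1 = r m - ell2_dot (r m) (split_choice m.+1) *: split_choice m.+1.
Proof. by []. Qed.

Lemma residual_kill m : (m <= j0)%N -> forall i, r m i = if (i < m)%N then 0 else split_start i.
Proof.
elim: m => [//|m IH] mj0 i; rewrite rS /split_choice mj0 succnK.
rewrite dot_std_basis ell2BE ell2ZE std_basisE !IH ?(ltnW mj0)// ltnn ltnS.
by case: ltngtP => [||->]; rewrite ?(mulr0, mulr1, subr0, subrr).
Qed.

Lemma residual_split n : r (j0 + n)%N =1 split_coef (split_state n).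
Proof.
elim: n => [|n IH] => [i|].
  rewrite addn0 residual_kill// split_startE /=.
  have N0 : (0 < N j0)%N by exact: leq_trans (N_ge9 _ (leqnn _)).
  rewrite mulr0n subr0 mulVf ?pnatr_eq0 -?lt0n// !mulr0 mulr1.
  have [ij0|ij0] := ltnP i j0; first by do ?case: ifPn => //; lia.
  have [ij|ij] := leqP i j0.*2; last by do ?case: ifPn => //; lia.
  have Xi : X i = c by apply: X0; lia.
  have Xj : X j0 = c by apply: X0; lia.
  do ?case: ifPn => //; lia.
rewrite addnS rS /split_choice (_ : (_ <= j0)%N = false); last by lia.
rewrite (_ : (_ - _).-1 = n); last by lia.
have [j0j _ kN] := split_stateP n.
rewrite [split_state n.+1]/= -/(split_state n).
by move: IH j0j kN; case: (split_state n) => j k IH /= j0j kN; exact: split_step.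
Qed.

(** In the first [j0] steps the coordinate [2 c] attains the supremum, so any [t <= 1] is met. Later
    the supremum is at most [2 X j] and the chosen coefficient at least [X j / (2 N j)], so
    [t <= 1 / (4 N j)] suffices. *)
Lemma split_realization : wga_realization ip (split_dictionary j0) t split_start split_choice.
Proof.
move=> [//|m] _; rewrite [m.+1.-1]/= -/(r m) /split_choice.
have c0 := c_gt0.
have [mj0|j0m] := ltnP m j0.
  split; first by left; exists m.
  rewrite /ip /= [X in _ <= X](_ : _ = 2 * c); last first.
    rewrite dot_std_basis residual_kill ?(ltnW mj0)// ltnn split_startE mj0.
    by rewrite ger0_norm// mulr_ge0// ltW.
  apply: (@le_trans _ _ (t m.+1 * (2 * c))); last first.
    by rewrite ler_piMl ?t_le1// mulr_ge0// ltW.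
  rewrite ler_wpM2l ?t_ge0//.
  apply: sup_split_le => i; rewrite residual_kill ?(ltnW mj0)// split_startE.
    by do ?case: ifPn => _; lra.
  by move=> j0i; do ?case: ifPn => //; lra || lia.
have -> : r m = r (j0 + (m - j0))%N by rewrite subnKC.
rewrite (_ : (_ - _).-1 = m - j0)%N; last by lia.
have := residual_split (m - j0); have := split_stateP (m - j0).
case: (split_state _) => j k /= [j0j jm kN] rE; split.
  right; exists j, (rot_sin (N j) k.+1), (rot_cos (N j) k.+1).
  have N0 : (0 < N j)%N by exact: leq_trans (N_ge9 _ j0j).
  by split=> //; [exact: rot_sin_ge0|exact: rot_cos_ge0|exact: rot_unit].
have N0 : (0 < N j)%N by exact: leq_trans (N_ge9 _ j0j).
have Xj := X_gt0 _ j0j.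
have supX : sup [set `|ip (r (j0 + (m - j0))%N) g| | g in split_dictionary j0] <= 2 * X j.
  have rX i : 0 <= r (j0 + (m - j0))%N i <= X j by rewrite rE split_coef_ge0// ltnW.
  by apply: sup_split_le => i; have := rX i; move=> /andP[]; lra.
rewrite /ip /= dot_split_dir//; apply: (@le_trans _ _ (t m.+1 * (2 * X j))).
  by rewrite ler_wpM2l// t_ge0.
apply: (le_trans _ (ler_norm _)).
have tN := t_le_N j m.+1; have {}tN : 4 * (N j)%:R * t m.+1 <= 1 by apply: tN; lia.
have N1 : 0 < (N j)%:R :> R by rewrite ltr0n.
rewrite (_ : _ * (2 * _) = X j * (2 * t m.+1)); last by ring.
rewrite ler_wpM2l ?(ltW Xj)//.
apply: le_trans (rot_coef_ge _ N0 (N_ge9 _ j0j) _ kN).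
by rewrite -[leRHS]mul1r ler_pdivlMr ?mulr_gt0//; lra.
Qed.

Let rea := split_realization.

Let dD := dictionary_split (R := R) j0.

Let normsq_rS m : `|r m.+1| ^+ 2 = `|r m| ^+ 2 - ell2_dot (r m) (split_choice m.+1) ^+ 2.
Proof. exact: (normsq_residualS (ell2_hilbert R) dD rea m). Qed.

Lemma residual_start_ge : j0.+1%:R * c ^+ 2 <= `|r j0| ^+ 2.
Proof.
rewrite ell2_normsq (le_trans _ (sum_sqr_le_dot (r j0) (j0 + j0.+1)))//.
rewrite big_split_ord /= ler_wpDl ?sumr_ge0// => [i _|]; first exact: sqr_ge0.
rewrite (eq_bigr (fun=> c ^+ 2)) => [|i _]; first by rewrite sumr_const card_ord mulr_natl.
rewrite residual_kill// split_startE ltnNge leq_addr /= ifT//.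
have := ltn_ord i; lia.
Qed.

(** Each rotation at node [i] costs at most [9/2 X_i^2 / N_i^2]; finished nodes are charged [N_i]
    rotations, the current one [k]. *)
Lemma residual_loss n : let: (j, k) := split_state n in
  `|r j0| ^+ 2 - \sum_(j0 <= i < j) 9 / 2 * X i ^+ 2 / (N i)%:R
    - k%:R * (9 / 2 * X j ^+ 2 / (N j)%:R ^+ 2) <= `|r (j0 + n)%N| ^+ 2.
Proof.
elim: n => [|n] /=; first by rewrite big_geq// mulr0n mul0r !subr0 addn0.
rewrite -/(split_state n) addnS normsq_rS.
rewrite {1}/split_choice (_ : (_ <= j0)%N = false); last by lia.
rewrite (_ : (_ - _).-1 = n); last by lia.
have := residual_split n; have := split_stateP n.
case: (split_state n) => j k /= [j0j _ kN] rE IH.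
have N0 : (0 < N j)%N by exact: leq_trans (N_ge9 _ j0j).
have N1 : 0 < (N j)%:R :> R by rewrite ltr0n.
rewrite /ip /= dot_split_dir// exprMn.
have : X j ^+ 2 * rot_coef (N j) k ^+ 2 <= X j ^+ 2 * (9 / 2 / (N j)%:R ^+ 2).
  by rewrite ler_wpM2l ?sqr_ge0// rot_coef_sqr_le.
rewrite (_ : _ * (9 / 2 / _) = 9 / 2 * X j ^+ 2 / (N j)%:R ^+ 2); last by ring.
move: IH; set d := 9 / 2 * X j ^+ 2 / (N j)%:R ^+ 2 => IH dle.
have kd : k.+1%:R * d = k%:R * d + d by rewrite -natr1 mulrDl mul1r.
case: ifPn => kN'; first by rewrite /= kd; lra.
rewrite /= big_nat_recr//= mulr0n mul0r subr0.
have -> : 9 / 2 * X j ^+ 2 / (N j)%:R = k.+1%:R * d.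
  rewrite (_ : k.+1 = N j) /d; last by lia.
  by field; rewrite gt_eqF.
rewrite kd; lra.
Qed.

Lemma residual_split_ge n : j0.+1%:R * c ^+ 2 / 2 <= `|r (j0 + n)%N| ^+ 2.
Proof.
have := residual_loss n; have := split_stateP n.
case: (split_state n) => j k /= [j0j _ kN]; apply: le_trans.
have N0 : (0 < N j)%N by exact: leq_trans (N_ge9 _ j0j).
have N1 : 0 < (N j)%:R :> R by rewrite ltr0n.
(* The unfinished node [j] is charged in full, which brings the loss under [sum_XN]. *)
have := sum_XN j.+1; rewrite big_nat_recr//=.
have : k%:R * (9 / 2 * X j ^+ 2 / (N j)%:R ^+ 2) <= 9 / 2 * X j ^+ 2 / (N j)%:R.
  rewrite -[leRHS](_ : (N j)%:R * (9 / 2 * X j ^+ 2 / (N j)%:R ^+ 2) = _).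
    by rewrite ler_wpM2r ?ler_nat ?(ltnW kN)// -mulrA mulr_ge0// divr_ge0 ?sqr_ge0.
  by field; rewrite gt_eqF.
have := residual_start_ge; lra.
Qed.

Lemma split_not_A1_converges : ~ A1_converges ip (split_dictionary j0) t.
Proof.
move=> /(_ _ _ A1_split_start rea) /cvgrPdist_lt.
set e := j0.+1%:R * c ^+ 2 / 2.
have e0 : 0 < e by rewrite divr_gt0// mulr_gt0// exprn_gt0// c_gt0.
have se0 : 0 < Num.sqrt e by rewrite sqrtr_gt0.
move=> /(_ _ se0)[n _ /(_ (j0 + n)%N (leq_addl _ _))/=].
rewrite sub0r normrN normr_id -/(r _) => small.
have : `|r (j0 + n)%N| ^+ 2 < Num.sqrt e ^+ 2 by rewrite ltr_pXn2r ?nnegrE ?(ltW se0).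
rewrite sqr_sqrtr ?(ltW e0)// => /lt_le_trans/(_ (residual_split_ge n)).
by rewrite ltxx.
Qed.

End splitting.

(** * Choice of the number of rotations *)

Section condensation.
Context {R : realType}.
Implicit Types (t T : nat -> R).

Lemma weakness_nincr t : (forall k, (0 < k)%N -> t k.+1 <= t k) ->
  forall m n, (0 < m <= n)%N -> t n <= t m.
Proof.
move=> tS m; elim=> [|n IH] /andP[m0]; first by move: m0; case: m.
rewrite leq_eqVlt ltnS => /predU1P[->//|mn].
by rewrite (le_trans (tS _ (leq_trans m0 mn)))// IH// m0.
Qed.

(** Cauchy condensation: the block from [2^S + 1] to [2^(S+1)] has [2^S] terms, each at least
    [t (2^(S+1)) / 2^(S+1)]. *)
Lemma condensation_le t S : (forall k, (0 < k)%N -> 0 <= t k) ->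
  (forall m n, (0 < m <= n)%N -> t n <= t m) ->
  \sum_(s < S) t (2 ^ s.+1)%N <= 2 * \sum_(1 <= k < (2 ^ S).+1) t k / k%:R.
Proof.
move=> t0 tS; elim: S => [|S IH].
  by rewrite big_ord0 mulr_ge0// big_nat sumr_ge0// => k /andP[k0 _]; rewrite divr_ge0 ?t0.
have S20 : (0 < 2 ^ S)%N by rewrite expn_gt0.
have S2 : (2 ^ S.+1 = 2 ^ S + 2 ^ S)%N by rewrite expnS mul2n addnn.
rewrite big_ord_recr /= (big_cat_nat _ (n := (2 ^ S).+1))//=; last by lia.
rewrite mulrDr lerD//.
apply: (@le_trans _ _ (2 * \sum_((2 ^ S).+1 <= k < (2 ^ S.+1).+1) t (2 ^ S.+1)%N / (2 ^ S.+1)%:R)).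
  rewrite sumr_const_nat (_ : (_ - _)%N = 2 ^ S)%N; last by lia.
  have n0 : (2 ^ S)%:R != 0 :> R by rewrite pnatr_eq0 -lt0n.
  rewrite -[X in 2 * X]mulr_natr S2 natrD le_eqVlt; apply/orP; left; apply/eqP.
  by field; rewrite -natrD pnatr_eq0; lia.
rewrite ler_wpM2l// !big_nat; apply: ler_sum => k /andP[k0 kS].
have k00 : (0 < k)%N by lia.
apply: ler_pM; rewrite ?t0 ?invr_ge0 ?expn_gt0//; first by apply: tS; lia.
by rewrite lef_pV2 ?posrE ?ltr0n ?expn_gt0// ler_nat; lia.
Qed.

Lemma sum_half_le S : \sum_(s < S) 2^-1 ^+ s <= 2 :> R.
Proof.
suff : \sum_(s < S) 2^-1 ^+ s = 2 - 2 * 2^-1 ^+ S :> R.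
  by move=> ->; rewrite gerBl mulr_ge0// exprn_ge0.
elim: S => [|S IH]; first by rewrite big_ord0 expr0 mulr1 subrr.
by rewrite big_ord_recr /= IH exprS; field.
Qed.

Lemma small_tail T B e : (forall s, 0 <= T s) -> (forall S, \sum_(s < S) T s <= B) ->
  0 < e -> exists s0, forall S, \sum_(s0 <= s < S) T s <= e.
Proof.
move=> T0 TB e0.
have nd : nondecreasing_seq (series T) by apply: nondecreasing_series.
have cT : cvgn (series T).
  by apply: nondecreasing_is_cvgn => //; exists B => _ [n _ <-]; rewrite series_ord.
have /cvgrPdist_lt/(_ e e0)[s0 _ /(_ s0 (leqnn s0))/= tail] := cT.
exists s0 => S; have [s0S|/ltnW Ss0] := leqP s0 S; last by rewrite big_geq// ltW.
rewrite -sub_series_geq// lerBlDl.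
apply: (le_trans (nondecreasing_cvgn_le nd cT S)).
by rewrite -lerBlDl; apply: le_trans (ltW tail); exact: ler_norm.
Qed.

End condensation.

(** * Levels of the binary tree *)

Section tree_level.
Implicit Types (i j s : nat).

Definition level i := trunc_log 2 i.+1.

Lemma level_split1 j : level j.*2.+1 = (level j).+1.
Proof. by rewrite /level -doubleS trunc_log2_double. Qed.

Lemma level_split2 j : level j.*2.+2 = (level j).+1.
Proof. by rewrite /level trunc_log2S//; congr (trunc_log 2 _).+1; lia. Qed.

Lemma levelE s i : (2 ^ s <= i.+1 < 2 ^ s.+1)%N -> level i = s.
Proof. by move=> si; apply: trunc_log_eq. Qed.

Lemma leq_level i j : (i <= j)%N -> (level i <= level j)%N.
Proof. by move=> ij; apply: leq_trunc_log. Qed.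

(** Level [s] has [2^s] nodes, each of weight [2^-s]. *)
Lemma sum_level (R : realType) (T : nat -> R) s0 S : (s0 <= S)%N ->
  \sum_((2 ^ s0).-1 <= i < (2 ^ S).-1) 2^-1 ^+ level i * T (level i) =
  \sum_(s0 <= s < S) T s.
Proof.
move=> /subnKC <-; elim: (S - s0)%N => [|d IH]; first by rewrite addn0 !big_geq.
rewrite addnS big_nat_recr/= ?leq_addr// -IH.
have p0 : (0 < 2 ^ (s0 + d))%N by rewrite expn_gt0.
have p1 : (2 ^ s0 <= 2 ^ (s0 + d))%N by rewrite leq_exp2l// leq_addr.
have S2 : (2 ^ (s0 + d).+1 = 2 ^ (s0 + d) + 2 ^ (s0 + d))%N by rewrite expnS mul2n addnn.
rewrite [LHS](big_cat_nat _ (n := (2 ^ (s0 + d)).-1))/=; [|lia|lia].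
congr (_ + _).
rewrite (eq_big_nat _ _ (F2 := fun=> 2^-1 ^+ (s0 + d) * T (s0 + d)%N)) => [|i il].
  rewrite sumr_const_nat (_ : (_ - _)%N = 2 ^ (s0 + d))%N; last by lia.
  rewrite -[X in X = _]mulr_natr natrX mulrAC -exprMn mulVf ?pnatr_eq0//.
  by rewrite expr1n mul1r.
by rewrite (levelE (s0 + d))//; lia.
Qed.

End tree_level.

(** * The counterexample built from a summable majorant *)

Section counterexample.
Context {R : realType} (t : nat -> R) (T : nat -> R) (s0 : nat).
Hypothesis t01 : forall k, (0 < k)%N -> 0 <= t k <= 1.
Hypothesis t_nincr : forall m n, (0 < m <= n)%N -> t n <= t m.
Hypothesis T_gt0 : forall s, 0 < T s.
Hypothesis tT : forall s, t (2 ^ s)%N <= T s.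
(** The relative loss is at most 9/2 * 8 = 36 times the tail of [T], and must not exceed 1/2; hence
    72. *)
Hypothesis T_tail : forall S, \sum_(s0 <= s < S) T s <= 72^-1.

(** The first node of level [s0], so that the nodes from [j0] to [2 j0] form exactly that level. *)
Let j0 := (2 ^ s0).-1.
Let c : R := (2 * j0.*2.+1%:R)^-1.
Let N s := Num.truncn (4 * T s)^-1.

Fixpoint level_coef s : R :=
  if s is s'.+1 then if (s' < s0)%N then c else level_coef s' * split_ratio (N s') else c.

Let c_gt0 : 0 < c. Proof. by rewrite invr_gt0 mulr_gt0. Qed.

Let T4 s : 0 < 4 * T s. Proof. by rewrite mulr_gt0. Qed.

Lemma T_small s : (s0 <= s)%N -> T s <= 72^-1.
Proof.
move=> s0s; have := T_tail s.+1; rewrite big_nat_recr//=; apply: le_trans.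
by rewrite lerDr sumr_ge0// => k _; exact: ltW.
Qed.

Lemma N_le s : 4 * (N s)%:R * T s <= 1.
Proof.
by rewrite mulrAC mulrC -ler_pdivlMr// mul1r /N truncn_le// invr_ge0 ltW.
Qed.

Lemma N_ge s : (s0 <= s)%N -> (9 <= N s)%N.
Proof.
move=> s0s; rewrite /N truncn_ge_nat ?invr_ge0 ?(ltW (T4 s))//.
rewrite -[leLHS]invrK lef_pV2 ?posrE//.
by have := T_small _ s0s; lra.
Qed.

(** Truncation costs at most a factor 2, since [N s + 1 <= 2 N s]. *)
Lemma N_inv_le s : (s0 <= s)%N -> (N s)%:R^-1 <= 8 * T s.
Proof.
move=> s0s; have N9 : 9 <= (N s)%:R :> R by rewrite (ler_nat _ 9) N_ge.
have : (4 * T s)^-1 < (N s).+1%:R by rewrite /N truncnS_gt.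
rewrite -(natr1 (N s)) -[_^-1]mul1r ltr_pdivrMr// => lt1.
by rewrite -[leLHS]mul1r ler_pdivrMr; have := T_gt0 s; nra.
Qed.

Lemma level_coef_base s : (s <= s0)%N -> level_coef s = c.
Proof. by case: s => //= s ->. Qed.

Lemma level_coefS s : (s0 <= s)%N ->
  level_coef s.+1 = level_coef s * split_ratio (N s).
Proof. by move=> s0s /=; rewrite ltnNge s0s. Qed.

Let N_pos s : (s0 <= s)%N -> (0 < N s)%N.
Proof. by move=> /N_ge; exact: leq_trans. Qed.

Lemma level_coef_gt0 s : (s0 <= s)%N -> 0 < level_coef s.
Proof.
move=> /subnKC <-; elim: (s - s0)%N => [|d IH]; first by rewrite addn0 level_coef_base.
have s0d := leq_addr d s0.
by rewrite addnS level_coefS// mulr_gt0// split_ratio_gt0 ?N_ge ?N_pos.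
Qed.

(** Each split at least halves the squared coordinate, starting from [c^2] at level [s0]. *)
Lemma level_coef_sqr_le s : (s0 <= s)%N ->
  level_coef s ^+ 2 <= c ^+ 2 * 2 ^+ s0 * 2^-1 ^+ s.
Proof.
move=> /subnKC <-; elim: (s - s0)%N => [|d IH].
  rewrite addn0 level_coef_base// -mulrA -exprMn divff ?pnatr_eq0//.
  by rewrite expr1n mulr1.
have s0d := leq_addr d s0.
rewrite addnS level_coefS// exprMn (exprSr _ (s0 + d)) [leRHS]mulrA.
by apply: ler_pM => //; rewrite ?sqr_ge0//; apply: split_ratio_sqr_le; exact: N_pos.
Qed.

Lemma level_coef_nincr s s' : (s0 <= s <= s')%N -> level_coef s' <= level_coef s.
Proof.
move=> /andP[s0s /subnKC <-]; elim: (s' - s)%N => [|d IH]; first by rewrite addn0.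
have s0d : (s0 <= s + d)%N by rewrite (leq_trans s0s) ?leq_addr.
rewrite addnS level_coefS// (le_trans _ IH)// ger_pMr ?level_coef_gt0//.
rewrite -(expr_le1 (n := 2))// ?(ltW (split_ratio_gt0 _ _ _)) ?N_ge ?N_pos//.
by apply: (le_trans (split_ratio_sqr_le _ _)); rewrite ?N_pos//; lra.
Qed.

Lemma counterexample_not_A1_converges :
  ~ A1_converges (ell2_dot : {dot (ell2 R) for idfun}) (split_dictionary j0) t.
Proof.
have p0 : (0 < 2 ^ s0)%N by rewrite expn_gt0.
have s0_level i : (j0 <= i)%N -> (s0 <= level i)%N.
  by move=> j0i; apply: trunc_log_max => //; rewrite /j0 in j0i; lia.
apply: (@split_not_A1_converges _ t j0 (fun j => N (level j)) (fun i => level_coef (level i)) c).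
- by move=> m /t01/andP[].
- by move=> m /t01/andP[].
- by [].
- move=> i /andP[j0i ij0]; rewrite level_coef_base// (levelE s0)// expnS.
  by rewrite /j0 in j0i ij0; lia.
- by move=> j j0j; rewrite level_split1 level_coefS// s0_level.
- by move=> j j0j; rewrite level_split2 level_coefS// s0_level.
- by move=> i /s0_level; exact: level_coef_gt0.
- by move=> i j /andP[j0i ij]; rewrite level_coef_nincr// s0_level//= leq_level.
- by move=> j /s0_level; exact: N_ge.
(* With [s] the level of [j], [2^s <= j + 1 <= m], so monotonicity gives [t m <= t (2^s) <= T s]. *)
- move=> j m /andP[_ jm]; apply: le_trans (N_le (level j)).
  rewrite ler_wpM2l ?mulr_ge0//; apply: le_trans (tT _).
  by apply: t_nincr; rewrite expn_gt0/=; apply: leq_trans jm; exact: trunc_logP.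
move=> n; have [nj0|j0n] := leqP n j0.
  by rewrite big_geq// divr_ge0// mulr_ge0// sqr_ge0.
have term i : (j0 <= i < n)%N -> 9 / 2 * level_coef (level i) ^+ 2 / (N (level i))%:R <=
    36 * (c ^+ 2 * 2 ^+ s0) * (2^-1 ^+ level i * T (level i)).
  move=> /andP[/s0_level s0i _].
  rewrite [leRHS](_ : _ = 9 / 2 * (c ^+ 2 * 2 ^+ s0 * 2^-1 ^+ level i) * (8 * T (level i)));
    last by field.
  apply: ler_pM; [by rewrite mulr_ge0 ?sqr_ge0|by rewrite invr_ge0| |exact: N_inv_le].
  by rewrite ler_wpM2l// level_coef_sqr_le.
rewrite big_nat (le_trans (ler_sum _ term))// -big_nat -mulr_sumr.
have s0n : (s0 <= n)%N by have := ltn_expl s0 (isT : 1 < 2)%N; rewrite /j0 in j0n; lia.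
have C0 : 0 <= 36 * (c ^+ 2 * 2 ^+ s0) by rewrite mulr_ge0// mulr_ge0 ?sqr_ge0.
(* The nodes below [n] lie on levels below [n], because [n <= 2^n - 1]; the sum is enlarged to full
   levels. *)
apply: (@le_trans _ _ (36 * (c ^+ 2 * 2 ^+ s0) * \sum_(s0 <= s < n) T s)).
  apply: ler_wpM2l => //; rewrite -sum_level// -/j0.
  rewrite [leRHS](big_cat_nat _ (n := n))/=; [|exact: ltnW|].
    by rewrite lerDl big_nat sumr_ge0// => i _; rewrite mulr_ge0 ?exprn_ge0// ltW.
  by have := ltn_expl n (isT : 1 < 2)%N; lia.
apply: (le_trans (ler_wpM2l C0 (T_tail n))).
rewrite /j0 prednK// natrX; lra.
Qed.

End counterexample.

Lemma exists_not_A1_converges (R : realType) (t : nat -> R) :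
  weakness_sequence t -> (forall k, (0 < k)%N -> t k.+1 <= t k) ->
  (\sum_(1 <= k <oo) (t k / k%:R)%:E < +oo)%E ->
  exists j0, ~ A1_converges (ell2_dot : {dot (ell2 R) for idfun}) (split_dictionary j0) t.
Proof.
move=> t01 /weakness_nincr tS fin.
have t0 k : (0 < k)%N -> 0 <= t k by move=> /t01/andP[].
have u0 k : (1 <= k)%N -> true -> (0 <= (t k / k%:R)%:E)%E.
  by move=> k0 _; rewrite lee_fin divr_ge0 ?t0.
have [B tB] : exists B, forall n, \sum_(1 <= k < n) t k / k%:R <= B.
  exists (fine (\sum_(1 <= k <oo) (t k / k%:R)%:E)%E) => n.
  rewrite -lee_fin fineK ?ge0_fin_numE ?nneseries_ge0// -sumEFin.
  exact: nneseries_lim_ge.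
(* The summable term [2^-s] makes [T] positive even where [t] vanishes, so that [1 / (4 T s)] is
   meaningful. *)
pose T s := t (2 ^ s)%N + 2^-1 ^+ s.
have T0 s : 0 < T s by rewrite ltr_wpDl ?t0 ?expn_gt0// exprn_gt0.
have TB S : \sum_(s < S) T s <= t 1%N + 2 * B + 2.
  rewrite big_split /= lerD ?sum_half_le//.
  case: S => [|S].
    by rewrite big_ord0 addr_ge0 ?t0// mulr_ge0// (le_trans _ (tB 0%N))// big_geq.
  rewrite big_ord_recl /= expn0 lerD2l.
  by apply: (le_trans (condensation_le t S t0 tS)); rewrite ler_wpM2l.
have e0 : 0 < 72^-1 :> R by rewrite invr_gt0.
have [s0 T_tail] := small_tail T _ 72^-1 (fun s => ltW (T0 s)) TB e0.
exists (2 ^ s0).-1; apply: (@counterexample_not_A1_converges _ t T) => //.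
by move=> s; rewrite lerDl exprn_ge0.
Qed.

Theorem theorem6p4 (R : realType) (t : nat -> R)
    (ht : weakness_sequence t)
    (hmono : forall k : nat, (0 < k)%N -> t k.+1 <= t k) :
  (\sum_(1 <= k <oo) (t k / k%:R)%:E = +oo)%E <->
  (forall (H : completeNormedModType R) (ip : {dot H for idfun}) (D : set H),
     hilbert_norm ip -> dictionary D -> A1_converges ip D t).
Proof.
split=> [tdiv H ip D Hip dD|conv].
  by apply: A1_converges_of_divergence => // k /ht/andP[].
apply/eqP; rewrite eq_le leey /= leNgt; apply/negP.
move=> /(exists_not_A1_converges _ _ ht hmono)[j0]; apply.
exact: (conv (ell2 R) _ _ (ell2_hilbert R) (dictionary_split j0)).
Qed.
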